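(* Let $\Delta>0$ and $p>0$. Suppose the times at which a web page changes form a time-homogeneous Poisson point process on $[0,\infty)$ with rate $\Delta$, and, independently, the page is accessed at times $0=t_0<t_1<t_2<\cdots$ where $\{t_k-t_{k-1}\}_{k\ge1}$ are i.i.d. exponential random variables with rate $p$. For $k\ge 1$ let $I_k=1$ if the page changed at least once in $(t_{k-1},t_k]$ and $I_k=0$ otherwise, and let $\hat I_k=\sum_{j=1}^k I_j$. Let $\{\alpha_k\}_{k\ge1}$ be a sequence of positive reals and define \[ x_k = \frac{p\,\hat I_k}{k+\alpha_k-\hat I_k},\qquad k\ge 1. \] Then: 1. If $\lim_{k\to\infty}\alpha_k/k=0$, then $\lim_{k\to\infty}x_k=\Delta$ almost surely. 2. If, in addition, $\lim_{k\to\infty}\log(k/\alpha_k)/k=0$, then \[ \mathbb{E}|x_k-\Delta| = O\left(\max\left\{k^{-1/2},\ \alpha_k/k\right\}\right). \]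
   Context: Here $\Delta$ is unknown (to be estimated) and $p$ is known; $x_k$ is called the LLN estimator. *)

(* Defs.v *)
From HB Require Import structures.
From mathcomp Require Import all_boot all_order all_algebra.
From mathcomp Require Import all_classical all_reals all_analysis.
Set Implicit Arguments.
Unset Strict Implicit.
Unset Printing Implicit Defensive.
Import Order.TTheory GRing.Theory Num.Def Num.Theory.
Import numFieldNormedType.Exports.
Local Open Scope classical_set_scope.
Local Open Scope ring_scope.

Definition mutual_indep {d d' : measure_display} {T : measurableType d}
    {T' : measurableType d'} {R : realType} (P : probability T R)
    {I : eqType} (X : I -> T -> T') : Prop :=
  forall (J : seq I) (B : I -> set T'), uniq J ->
    (forall i, measurable (B i)) ->
    P (\bigcap_(i in [set` J]) (X i @^-1` B i)) =
    (\prod_(i <- J) P (X i @^-1` B i))%E.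

Definition indep_families {d d1 d2 : measure_display} {T : measurableType d}
    {T1 : measurableType d1} {T2 : measurableType d2} {R : realType}
    (P : probability T R) {I1 I2 : eqType}
    (X1 : I1 -> T -> T1) (X2 : I2 -> T -> T2) : Prop :=
  forall (J1 : seq I1) (J2 : seq I2) (B1 : I1 -> set T1) (B2 : I2 -> set T2),
    (forall i, measurable (B1 i)) -> (forall i, measurable (B2 i)) ->
    P (\bigcap_(i in [set` J1]) (X1 i @^-1` B1 i) `&`
       \bigcap_(i in [set` J2]) (X2 i @^-1` B2 i)) =
    (P (\bigcap_(i in [set` J1]) (X1 i @^-1` B1 i)) *
     P (\bigcap_(i in [set` J2]) (X2 i @^-1` B2 i)))%E.

(* Time-homogeneous Poisson point process on [0, oo) with rate D, given by
   its counting process: N t w = number of points in (0, t].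
   Paths are nondecreasing, right-continuous (integer-valued, so locally
   constant to the right), start at 0; increments over disjoint intervals
   are independent and N t - N s ~ Poisson(D (t - s)). *)
Definition poisson_process {d : measure_display} {T : measurableType d}
    {R : realType} (P : probability T R) (D : R) (N : R -> T -> nat) : Prop :=
  [/\ (forall t, measurable_fun setT (N t)),
      (forall w, N 0 w = 0%N),
      (forall w s t, 0 <= s -> s <= t -> (N s w <= N t w)%N) /\
      (forall w t, 0 <= t -> exists2 e : R, 0 < e &
          forall u, t <= u -> u < t + e -> N u w = N t w),
      (forall (n : nat) (s : nat -> R), 0 <= s 0%N ->
          (forall i, (i < n)%N -> s i <= s i.+1) ->
          mutual_indep P (fun i : 'I_n => fun w => (N (s i.+1) w - N (s i) w)%N)) &
      (forall s t (k : nat), 0 <= s -> s < t ->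
          P [set w | (N t w - N s w)%N = k] = (poisson_pmf (D * (t - s)) k)%:E) ].

Definition access_time {T : Type} {R : realType} (tau : nat -> T -> R)
    (k : nat) (w : T) : R :=
  \sum_(j < k) tau j w.

Definition change_ind {T : Type} {R : realType} (N : R -> T -> nat)
    (tau : nat -> T -> R) (k : nat) (w : T) : nat :=
  (N (access_time tau k.-1 w) w < N (access_time tau k w) w)%N.

Definition change_count {T : Type} {R : realType} (N : R -> T -> nat)
    (tau : nat -> T -> R) (k : nat) (w : T) : nat :=
  (\sum_(1 <= j < k.+1) change_ind N tau j w)%N.

Definition lln_estimator {T : Type} {R : realType} (p : R) (alpha : nat -> R)
    (N : R -> T -> nat) (tau : nat -> T -> R) (k : nat) (w : T) : R :=
  p * (change_count N tau k w)%:R /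
    (k%:R + alpha k - (change_count N tau k w)%:R).

(* Main.v *)
(* Round every access gap up to a multiple of a mesh [h].  The rounded gaps are
   geometric, and given their values the increments of the counting process
   over them are independent, so the change indicators become i.i.d. Bernoulli
   and the moment generating function of their sum is explicit.  The rounded
   times decrease to the true ones as [h] tends to [0], and the paths are
   right-continuous, so by Fatou's lemma the centred count [Z = I_k - k q], with
   [q = D / (p + D)], satisfies [E exp (l Z) <= exp (2 k l^2)] for [l <= 1/2].

   This gives exponential tails, hence [Z / k -> 0] almost surely by
   Borel-Cantelli, and the estimator is a continuous function of [Z / k] and
   [alpha_k / k].  For the rate, put [r = 1 - q].  Where [Z <= k r / 2] the error
   is at most [2 ((p + D) |Z| + D alpha_k) / (k r)], and elsewhere at most
   [p k / alpha_k + D]; both are dominated by exponentials of [Z], and the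
   assumption on [ln (k / alpha_k)] absorbs the factor [k / alpha_k] into the
   exponentially small probability of the second event. *)
Require Import Defs.
From mathcomp Require Import all_boot all_order all_algebra.
From mathcomp Require Import all_classical all_reals all_analysis.
From mathcomp Require Import measurable_realfun measurable_fun_approximation.
From mathcomp Require Import ring lra.
Set Implicit Arguments.
Unset Strict Implicit.
Unset Printing Implicit Defensive.
Import Order.TTheory GRing.Theory Num.Def Num.Theory.
Import numFieldNormedType.Exports.
Local Open Scope classical_set_scope.
Local Open Scope ring_scope.

(** * Independence of the counts and the access gaps *)

Lemma measure_fibers d (T : measurableType d) (R : realType)
    (mu : {measure set T -> \bar R}) (M : T -> nat) (A : set T) :
  measurable_fun setT M -> measurable A ->
  mu A = (\sum_(0 <= i <oo) mu (A `&` M @^-1` [set i]))%E.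
Proof.
move=> mM mA.
have mAi i : measurable (A `&` M @^-1` [set i]).
  by apply: measurableI => //; rewrite -[_ @^-1` _]setTI; exact: mM.
rewrite -measure_semi_bigcup //.
- by congr (mu _); apply/seteqP; split=> [w Aw|w [i _ []//]]; exists (M w).
- apply/trivIsetP => i j _ _ /eqP ij; apply/seteqP; split => // w.
  by move=> -[[_ /= Mi] [_ /= Mj]]; apply: ij; rewrite -Mi.
- exact: bigcupT_measurable.
Qed.

(** Summing a joint law of product form over all values of the [M j] gives the product of the sums.
    The induction peels off the last coordinate, which is why [A] and [C] vary: fixing [M k = c]
    replaces [A] by a smaller event and [C] by [C * f k c]. *)
Lemma measure_joint_fibers d (T : measurableType d) (R : realType)
    (mu : {measure set T -> \bar R}) (M : nat -> T -> nat)
    (f : nat -> nat -> R) (F : nat -> R) (k : nat) (A : set T) (C : R) :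
  (forall j, measurable_fun setT (M j)) ->
  (forall j, series (f j) @ \oo --> F j) ->
  measurable A ->
  (forall m : nat -> nat,
    mu (A `&` [set w | forall j, (j < k)%N -> M j w = m j]) =
    (C * \prod_(j < k) f j (m j))%:E) ->
  mu A = (C * \prod_(j < k) F j)%:E.
Proof.
move=> mM fF; elim: k A C => [|k IH] A C mA H.
  have := H (fun=> 0%N); rewrite !big_ord0 => <-; congr (mu _).
  by apply/seteqP; split => // w [].
have mM1 c : measurable (M k @^-1` [set c]).
  by rewrite -[_ @^-1` _]setTI; exact: mM.
have HI c : mu (A `&` M k @^-1` [set c]) = (C * f k c * \prod_(j < k) F j)%:E.
  apply: IH; first exact: measurableI.
  move=> m; pose m' j := if j == k then c else m j.
  have := H m'; rewrite big_ord_recr/= /m' eqxx => H'.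
  transitivity ((C * (\prod_(i < k) f i (if i == k :> nat then c else m i) *
    f k c))%:E); last first.
    congr EFin; rewrite -!mulrA; congr (_ * _); rewrite mulrC; congr (_ * _).
    by apply: eq_bigr => i _; rewrite ltn_eqF.
  rewrite -H'; congr (mu _); apply/seteqP; split => [w [[Aw Mw] mw]|w [Aw mw]] /=.
    split=> // j; case: eqVneq => [-> _ //|jk jk1]; apply: mw.
    by rewrite ltn_neqAle jk.
  split; last by move=> j jk; rewrite mw ?(ltn_trans jk)// ltn_eqF.
  by split=> //; have := mw k (leqnn _); rewrite eqxx.
rewrite (measure_fibers mu (mM k)) //; apply/cvg_lim => //.
rewrite big_ord_recr/=.
have -> : (fun n => (\sum_(0 <= i < n) mu (A `&` M k @^-1` [set i])))%E =
    (fun n => (C * \prod_(j < k) F j * series (f k) n)%:E).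
  apply/funext => n; under eq_bigr do rewrite HI.
  rewrite sumEFin; congr EFin; rewrite /series/= mulr_sumr.
  by apply: eq_bigr => i _; ring.
apply: cvg_EFin; first exact: nearW.
by rewrite mulrA; apply: cvgMl_tmp => //; exact: fF.
Qed.

(** Only fibres through a point [w] are required, so that they can be described by the values taken
    at [w]; all other fibres are empty. *)
Lemma measurable_nat_fibers d (T : measurableType d) (V : T -> nat) :
  (forall w, measurable (V @^-1` [set V w])) -> measurable_fun setT V.
Proof.
move=> mV _ Y _; rewrite setTI.
have -> : V @^-1` Y = \bigcup_(i in Y) V @^-1` [set i].
  apply/seteqP; split => [w Yw|w [i Yi /= Vi]] /=.
    by exists (V w).
  by rewrite Vi.
apply: bigcup_measurable => i _.
have [->|/set0P[w /= <-]] := eqVneq (V @^-1` [set i]) set0 => //.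
Qed.

Lemma preimage_indep_fibers d (T : measurableType d) (R : realType)
    (P : probability T R) (V : T -> nat) (B : set T) (Q : set nat) :
  measurable_fun setT V -> measurable B ->
  (forall w, P (V @^-1` [set V w] `&` B) = P (V @^-1` [set V w]) * P B)%E ->
  (P (V @^-1` Q `&` B) = P (V @^-1` Q) * P B)%E.
Proof.
move=> mV mB VB.
have mQ : measurable (V @^-1` Q) by rewrite -[_ @^-1` _]setTI; exact: mV.
rewrite (measure_fibers P mV (measurableI _ _ mQ mB)) (measure_fibers P mV mQ).
have fB : P B = (fine (P B))%:E by rewrite fineK ?fin_num_measure.
rewrite fB [RHS]muleC -nneseriesZl //; apply: eq_eseriesr => i _.
rewrite -fB [RHS]muleC.
have [Qi|Qi] := pselect (Q i); last first.
  have -> : V @^-1` Q `&` V @^-1` [set i] = set0.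
    by apply/seteqP; split => // w [/= QV Vi]; apply: Qi; rewrite -Vi.
  have -> : V @^-1` Q `&` B `&` V @^-1` [set i] = set0.
    by apply/seteqP; split => // w [[/= QV _] Vi]; apply: Qi; rewrite -Vi.
  by rewrite measure0 mul0e.
have -> : V @^-1` Q `&` V @^-1` [set i] = V @^-1` [set i].
  by apply/seteqP; split => [w []//|w /= Vi]; split => //=; rewrite Vi.
have -> : V @^-1` Q `&` B `&` V @^-1` [set i] = V @^-1` [set i] `&` B.
  apply/seteqP; split => [w [[]//]|w /= [Vi Bw]]; split => //=; split => //=.
  by rewrite Vi.
have [->|/set0P[w /= <-]] := eqVneq (V @^-1` [set i]) set0; last exact: VB.
by rewrite set0I measure0 mul0e.
Qed.

(** [pickle] injectively codes a finite vector of counts as one natural number, so the fibre lemmas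
    for [nat]-valued maps apply to vectors and each fibre is a rectangle. *)
Lemma preimage_pickle_map (I : eqType) T (X : I -> T -> nat) (s : seq I) (w0 : T) :
  (fun w => pickle [seq X i w | i <- s]) @^-1` [set pickle [seq X i w0 | i <- s]] =
  \bigcap_(i in [set` s]) X i @^-1` [set X i w0].
Proof.
apply/seteqP; split => [w /= /(pcan_inj pickleK)/eq_in_map ww0 i /= si|w ww0 /=].
  exact: ww0.
by congr pickle; apply/eq_in_map => i si; exact: ww0.
Qed.

(* The countably many values of a finite vector of counts split any event on
   that vector into the rectangles for which independence is assumed. *)
Lemma indep_families_counts d d2 (T : measurableType d) (T2 : measurableType d2)
    (R : realType) (P : probability T R) (I1 I2 : eqType)
    (X : I1 -> T -> nat) (Y : I2 -> T -> T2) (s : seq I1) (Q : set (seq nat))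
    (J : seq I2) (B : I2 -> set T2) :
  indep_families P X Y -> (forall i, measurable_fun setT (X i)) ->
  (forall i, measurable_fun setT (Y i)) -> (forall i, measurable (B i)) ->
  (P ([set w | Q [seq X i w | i <- s]] `&` \bigcap_(i in [set` J]) Y i @^-1` B i) =
   P [set w | Q [seq X i w | i <- s]] * P (\bigcap_(i in [set` J]) Y i @^-1` B i))%E.
Proof.
move=> XY mX mY mB.
pose V w := pickle [seq X i w | i <- s].
have -> : [set w | Q [seq X i w | i <- s]] = V @^-1` (pickle @` Q).
  apply/seteqP; split => [w Qw|w [l Ql /(pcan_inj pickleK) lE]] /=.
    by exists [seq X i w | i <- s].
  by rewrite -lE.
have mXi i w : measurable (X i @^-1` [set X i w]).
  by rewrite -[_ @^-1` _]setTI; exact: mX.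
have mV : measurable_fun setT V.
  apply: measurable_nat_fibers => w; rewrite preimage_pickle_map.
  exact: fin_bigcap_measurable.
apply: preimage_indep_fibers => //.
  apply: fin_bigcap_measurable => // i _.
  by rewrite -[_ @^-1` _]setTI; exact: mY.
move=> w; rewrite preimage_pickle_map.
exact: (XY s J (fun i => [set X i w])).
Qed.

(** * Access gaps rounded up to a grid *)

Lemma exponential_prob_lt (R : realType) (p x : R) : 0 < p -> 0 <= x ->
  exponential_prob p [set y | y < x] = (1 - expR (- p * x))%:E.
Proof.
move=> p0 x0; have mpdf D' : measurable D' ->
    measurable_fun D' (fun y => (exponential_pdf p y)%:E).
  move=> mD'; apply/measurable_EFinP; apply: measurable_funTS.
  exact: measurable_exponential_pdf.
have -> : [set y : R | y < x] = `]-oo, 0[ `|` `[0, x[.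
  apply/seteqP; split => y /=; rewrite !in_itv/=.
    by case: (ltP y 0) => y0 yx; [left|right].
  by case=> [y0|/andP[]//]; exact: lt_le_trans x0.
rewrite /exponential_prob ge0_integral_setU //=; last 3 first.
- by apply: mpdf; exact: measurableU.
- by move=> y _; rewrite lee_fin exponential_pdf_ge0// ltW.
- apply/disj_set2P/seteqP; split => // y []/=; rewrite !in_itv/= => y0 /andP[].
  by rewrite leNgt y0.
rewrite [X in (X + _)%E]integral0_eq ?add0e; last first.
  by move=> y /=; rewrite in_itv/= => y0; rewrite lt0_exponential_pdf.
have [->|xn0] := eqVneq x 0.
  by rewrite set_itvco0 ?integral_set0// mulr0 expR0 subrr.
rewrite integral_itv_bndo_bndc; last exact: mpdf.
rewrite EFinB -[LHS]/(exponential_prob p `[0, x]) exponential_prob_itv0c//.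
by rewrite lt_neqAle eq_sym xn0.
Qed.

(** The cell is [[h m, h (m + 1))] for positive [m]. Since [truncn] sends negative numbers to 0, the
    cell of 0 is a whole half-line, whence the guard [0 < m]. *)
Lemma truncn_divE (R : realType) (h : R) m : 0 < h ->
  [set y : R | truncn (y / h) = m] =
  [set y | y < h * m.+1%:R] `\` [set y | (0 < m)%N && (y < h * m%:R)].
Proof.
move=> h0; apply/seteqP; split => y /=; rewrite ![h * _]mulrC -!ltr_pdivrMr//.
  move=> <-; rewrite truncnS_gt; split=> //;
    case: (truncn _) (truncn_le_nat (y / h)) => //.
  by move=> n /(_ n); rewrite ltnn => <-.
rewrite -truncn_le_nat; case: m => [|m]; first by rewrite leqn0 => -[/eqP].
by rewrite -truncn_le_nat/= => -[ym /negP ym'];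
  apply/eqP; rewrite eqn_leq ym ltnNge ym'.
Qed.

Lemma measurable_truncn_div (R : realType) (h : R) m : 0 < h ->
  measurable [set y : R | truncn (y / h) = m].
Proof.
have mlt (x : R) : measurable [set y : R | y < x].
  by rewrite -set_itvNyo; exact: measurable_itv.
move=> h0; rewrite truncn_divE //; apply: measurableD => //.
by case: m => [|m] //=; rewrite set_false.
Qed.

(** A cell has the difference of the distribution function at its two ends as probability, so the
    cell index is geometric with ratio [expR (- (p * h))]. *)
Lemma exponential_grid d (T : measurableType d) (R : realType)
    (P : probability T R) (p h : R) (X : T -> R) m : 0 < p -> 0 < h ->
  measurable_fun setT X ->
  (forall B, measurable B -> P (X @^-1` B) = exponential_prob p B) ->
  P (X @^-1` [set y | truncn (y / h) = m]) =
  (expR (- (p * h)) ^+ m * (1 - expR (- (p * h))))%:E.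
Proof.
move=> p0 h0 mX PX.
have mlt (x : R) : measurable [set y : R | y < x].
  by rewrite -set_itvNyo; exact: measurable_itv.
have mXlt x : measurable (X @^-1` [set y | y < x]).
  by rewrite -[_ @^-1` _]setTI; exact: mX.
have Plt n : P (X @^-1` [set y | y < h * n%:R]) = (1 - expR (- (p * h)) ^+ n)%:E.
  rewrite PX// exponential_prob_lt ?mulr_ge0 ?(ltW h0)//.
  by rewrite -expRM_natl; congr (1 - expR _)%:E; ring.
rewrite truncn_divE //; case: m => [|m] /=.
  rewrite [X in _ @^-1` (_ `\` X)](_ : _ = set0); last by apply/seteqP; split.
  by rewrite setD0 Plt expr1 expr0 mul1r.
rewrite -[X in P X]/(X @^-1` [set y | y < h * m.+2%:R] `\`
  X @^-1` [set y | y < h * m.+1%:R]).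
rewrite measureD //; last by rewrite ltey_eq fin_num_measure.
rewrite [X in (_ - P X)%E](_ : _ = X @^-1` [set y | y < h * m.+1%:R]); last first.
  apply/seteqP; split => [w []//|w /= Xm]; split=> //=.
  by rewrite (lt_trans Xm)// ltr_pM2l// ltr_nat.
rewrite [X in (X - _)%E](Plt m.+2) (Plt m.+1) -EFinB; congr EFin; rewrite !exprS; ring.
Qed.

(** * Poisson counts observed along the grid *)

Lemma poisson_no_points d (T : measurableType d) (R : realType)
    (P : probability T R) (D : R) (N : R -> T -> nat) s t :
  0 < D -> poisson_process P D N -> 0 <= s -> s < t ->
  P [set w | (N t w - N s w)%N = 0%N] = (expR (- (D * (t - s))))%:E.
Proof.
move=> D0 [_ _ _ _ NP] s0 st; rewrite NP // /poisson_pmf.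
by rewrite mulr_gt0 ?subr_gt0// expr0 fact0 invr1 !mul1r.
Qed.

(** Here [x] is the probability of no change, and [true] stands for a change. *)
Definition gap_prob {R : realType} (x : R) (b : bool) : R :=
  if b then 1 - x else x.

(** At deterministic times the [j]-th indicator depends on the [j]-th increment alone, so
    independent increments factor the pattern, and only the probability of a zero increment is
    computed. *)
Lemma poisson_gap_pattern d (T : measurableType d) (R : realType)
    (P : probability T R) (D : R) (N : R -> T -> nat) (s : nat -> R)
    (b : nat -> bool) k :
  0 < D -> poisson_process P D N -> 0 <= s 0%N ->
  (forall i, (i < k)%N -> s i < s i.+1) ->
  P [set w | forall j, (j < k)%N -> (N (s j) w < N (s j.+1) w)%N = b j] =
  (\prod_(j < k) gap_prob (expR (- (D * (s j.+1 - s j)))) (b j))%:E.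
Proof.
move=> D0 NP s0 sS; have s_ge0 i : (i <= k)%N -> 0 <= s i.
  by elim: i => // i IH ik; rewrite (le_trans (IH (ltnW ik)))// ltW// sS.
have [mN _ _ Nindep _] := NP.
pose incr (i : 'I_k) w := (N (s i.+1) w - N (s i) w)%N.
have mincr i : measurable_fun setT (incr i) by exact: measurable_fun_subn.
have -> : [set w | forall j, (j < k)%N -> (N (s j) w < N (s j.+1) w)%N = b j] =
    \bigcap_(i in [set` index_enum 'I_k]) incr i @^-1` [set x | (0 < x)%N = b i].
  apply/seteqP; split => [w wb i _ /=|w wb j jk /=].
    by rewrite /incr subn_gt0 wb.
  by rewrite -(wb (Ordinal jk) (mem_index_enum _))/= subn_gt0.
rewrite (Nindep k s) ?index_enum_uniq //; last by move=> i ik; rewrite ltW ?sS.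
rewrite -prodEFin; apply: eq_bigr => i _.
have P0 : P [set w | incr i w = 0%N] = (expR (- (D * (s i.+1 - s i))))%:E.
  by apply: poisson_no_points => //; [exact: s_ge0 (ltnW _)|exact: sS].
rewrite /gap_prob; case: (b i).
  rewrite [X in P X](_ : _ = ~` [set w | incr i w = 0%N]); last first.
    by apply/seteqP; split => w /=; rewrite lt0n -/(incr i w) => /eqP.
  rewrite probability_setC ?P0 -?EFinB //.
  by have := mincr i measurableT [set 0%N] I; rewrite setTI.
rewrite -P0; congr (P _); apply/seteqP; split => w /=; rewrite -/(incr i w).
  by case: (incr i w).
by move=> ->.
Qed.

(** The successor rounds up rather than down: rounded times must approach the true ones from the
    right, where paths are locally constant. It also keeps every step positive. *)
Definition grid_step {T : Type} {R : realType} (h : R) (tau : nat -> T -> R)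
    (j : nat) (w : T) : R :=
  h * (truncn (tau j w / h)).+1%:R.

(** Joint probability that a rounded gap equals [h * m.+1] and has change indicator [b]: a geometric
    mass times a Poisson probability over that length. *)
Definition grid_weight {R : realType} (D p h : R) (b : bool) (m : nat) : R :=
  expR (- (p * h)) ^+ m * (1 - expR (- (p * h))) *
  gap_prob (expR (- (D * h)) ^+ m.+1) b.

Definition change_pattern {T : Type} {R : realType} (N : R -> T -> nat)
    (tau : nat -> T -> R) (k : nat) (b : nat -> bool) : set T :=
  [set w | forall j, (j < k)%N -> change_ind N tau j.+1 w = b j].

(** Once the cell indices are fixed, the rounded access times are deterministic, so the pattern
    becomes an event on [N] at fixed times. Independence of [N] and [tau] then separates it from the
    event on the gaps. *)
Lemma grid_pattern_fiber d (T : measurableType d) (R : realType)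
    (P : probability T R) (D p h : R) (N : R -> T -> nat) (tau : nat -> T -> R)
    (b : nat -> bool) (k : nat) (m : nat -> nat) :
  0 < D -> 0 < p -> 0 < h ->
  poisson_process P D N ->
  (forall k, measurable_fun setT (tau k)) ->
  mutual_indep P tau ->
  (forall k (B : set R), measurable B ->
     P (tau k @^-1` B) = exponential_prob p B) ->
  indep_families P N tau ->
  P (change_pattern N (grid_step h tau) k b `&`
     [set w | forall j, (j < k)%N -> truncn (tau j w / h) = m j]) =
  (\prod_(j < k) grid_weight D p h (b j) (m j))%:E.
Proof.
move=> D0 p0 h0 NP mtau itau Ptau Ntau.
(* The deterministic times are access times over a one-point sample space. *)
pose s j := access_time (fun i (_ : unit) => h * (m i).+1%:R) j tt.
have sS i : s i.+1 - s i = h * (m i).+1%:R.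
  by rewrite /s /access_time big_ord_recr/= addrAC subrr add0r.
have [mN _ _ _ _] := NP.
pose B j := [set y : R | truncn (y / h) = m j].
have mB j : measurable (B j) by exact: measurable_truncn_div.
(* The pattern as a property of the list of counts at [s 0], ..., [s k], the form that
   [indep_families_counts] accepts. *)
pose Q (l : seq nat) :=
  forall j, (j < k)%N -> (nth 0 l j < nth 0 l j.+1)%N = b j.
have nthN w j : (j <= k)%N ->
    nth 0%N [seq N x w | x <- [seq s i | i <- iota 0 k.+1]] j = N (s j) w.
  move=> jk; rewrite -map_comp (nth_map 0%N) ?size_iota ?ltnS//.
  by rewrite nth_iota ?ltnS.
have QE : [set w | Q [seq N x w | x <- [seq s i | i <- iota 0 k.+1]]] =
    [set w | forall j, (j < k)%N -> (N (s j) w < N (s j.+1) w)%N = b j].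
  apply/seteqP; split => w /= + j jk => /(_ j jk); rewrite !nthN //; exact: ltnW.
have -> : change_pattern N (grid_step h tau) k b `&`
     [set w | forall j, (j < k)%N -> truncn (tau j w / h) = m j] =
    [set w | Q [seq N x w | x <- [seq s i | i <- iota 0 k.+1]]] `&`
    \bigcap_(j in [set` iota 0 k]) tau j @^-1` B j.
  have accE w : (forall j, (j < k)%N -> truncn (tau j w / h) = m j) ->
      forall j, (j <= k)%N -> access_time (grid_step h tau) j w = s j.
    move=> wm j jk; rewrite /s /access_time; apply: eq_bigr => i _.
    by rewrite /grid_step wm// (leq_trans _ jk).
  rewrite QE; apply/seteqP; split => [w [wb wm]|w [wb wm]].
    split => [j jk|j /=]; last by rewrite mem_iota/= add0n; exact: wm.
    have := wb j jk; rewrite /change_ind /= !(accE w wm) ?(ltnW jk)//.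
    by case: (_ < _)%N; case: (b j).
  have {}wm : forall j, (j < k)%N -> truncn (tau j w / h) = m j.
    by move=> j jk; apply: wm; rewrite /= mem_iota.
  split=> // j jk; rewrite /change_ind /= !(accE w wm) ?(ltnW jk)//.
  by rewrite (wb j jk).
rewrite indep_families_counts // QE (poisson_gap_pattern (s := s) _ D0 NP) //; last 2 first.
- by rewrite /s /access_time big_ord0.
- by move=> i _; rewrite -subr_gt0 sS mulr_gt0.
rewrite itau ?iota_uniq //.
have -> : (\prod_(j <- iota 0 k) P (tau j @^-1` B j))%E =
    (\prod_(j < k) (expR (- (p * h)) ^+ m j * (1 - expR (- (p * h)))))%:E.
  rewrite -prodEFin -(big_mkord xpredT (fun j => (_ ^+ m j * _)%:E)) /index_iota subn0.
  apply: eq_bigr => j _; exact: exponential_grid (Ptau j).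
rewrite -EFinM mulrC -big_split/=; congr EFin; apply: eq_bigr => j _.
rewrite /grid_weight sS; congr (_ * gap_prob _ _).
by rewrite -expRM_natl; congr expR; ring.
Qed.

(** Probability of no change over one rounded gap: with [u = expR (- (p * h))] and
    [v = expR (- (D * h))], the sum over [m] of [u ^+ m * (1 - u) * v ^+ m.+1]. *)
Definition grid_gap {R : realType} (D p h : R) : R :=
  (1 - expR (- (p * h))) * expR (- (D * h)) / (1 - expR (- (p * h)) * expR (- (D * h))).

Lemma grid_weight_series (R : realType) (D p h : R) (b : bool) :
  0 < D -> 0 < p -> 0 < h ->
  series (grid_weight D p h b) @ \oo --> gap_prob (grid_gap D p h) b.
Proof.
move=> D0 p0 h0; rewrite /grid_weight /grid_gap.
set u := expR (- (p * h)); set v := expR (- (D * h)).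
have u0 : 0 < u by exact: expR_gt0.
have v0 : 0 < v by exact: expR_gt0.
have u1 : u < 1 by rewrite -[ltRHS]expR0 ltr_expR oppr_lt0 mulr_gt0.
have v1 : v < 1 by rewrite -[ltRHS]expR0 ltr_expR oppr_lt0 mulr_gt0.
have cgap : series (fun m => u ^+ m * (1 - u) * v ^+ m.+1) @ \oo -->
    (1 - u) * v / (1 - u * v).
  have -> : (fun m => u ^+ m * (1 - u) * v ^+ m.+1) = geometric ((1 - u) * v) (u * v).
    by apply/funext => m; rewrite /geometric/= exprMn exprS; ring.
  apply: cvg_geometric_series; rewrite ger0_norm ?mulr_ge0 ?(ltW u0) ?(ltW v0)//.
  by rewrite -[ltRHS]mulr1 ltr_pM ?ltW.
case: b => //=.
(* A change is the complement of no change: subtract the series just summed from the total geometric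
   mass, which is 1. *)
have -> : series (fun m => u ^+ m * (1 - u) * (1 - v ^+ m.+1)) =
    (fun n => series (geometric (1 - u) u) n -
              series (fun m => u ^+ m * (1 - u) * v ^+ m.+1) n).
  apply/funext => n; rewrite /series/= -sumrB; apply: eq_bigr => m _.
  by rewrite /geometric/=; ring.
apply: cvgB => //.
rewrite -[X in _ --> X](@divff _ (1 - u)) ?gt_eqF ?subr_gt0//.
by apply: cvg_geometric_series; rewrite gtr0_norm.
Qed.

(** Evaluating a process at a random time is measurable when that time takes countably many values,
    as rounded access times do: split on the value. *)
Lemma measurable_fun_nat_index d (T : measurableType d) d' (T' : measurableType d')
    (M : T -> nat) (F : nat -> T -> T') :
  measurable_fun setT M -> (forall n, measurable_fun setT (F n)) ->
  measurable_fun setT (fun w => F (M w) w).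
Proof.
move=> mM mF _ Y mY; rewrite setTI.
have -> : (fun w => F (M w) w) @^-1` Y =
    \bigcup_n (M @^-1` [set n] `&` F n @^-1` Y).
  apply/seteqP; split => [w Yw|w [n _ [/= Mn Fn]]] /=; last by rewrite Mn.
  by exists (M w).
apply: bigcupT_measurable => n; apply: measurableI.
  by rewrite -[_ @^-1` _]setTI; exact: mM.
by rewrite -[_ @^-1` _]setTI; exact: mF.
Qed.

Lemma measurable_grid_index d (T : measurableType d) (R : realType) (h : R)
    (X : T -> R) :
  0 < h -> measurable_fun setT X -> measurable_fun setT (fun w => truncn (X w / h)).
Proof.
move=> h0 mX; apply: measurable_nat_fibers => w.
have := mX measurableT _ (measurable_truncn_div (truncn (X w / h)) h0).
by rewrite setTI.
Qed.

Lemma measurable_fun_sumn d (T : measurableType d) (I : Type) (r : seq I)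
    (f : I -> T -> nat) :
  (forall i, measurable_fun setT (f i)) ->
  measurable_fun setT (fun w => \sum_(i <- r) f i w)%N.
Proof.
move=> mf; elim: r => [|i r IH].
  by under eq_fun do rewrite big_nil; exact: measurable_cst.
by under eq_fun do rewrite big_cons; exact: measurable_fun_addn.
Qed.

Lemma measurable_change_ind_grid d (T : measurableType d) (R : realType) (h : R)
    (N : R -> T -> nat) (tau : nat -> T -> R) j :
  0 < h -> (forall t, measurable_fun setT (N t)) ->
  (forall k, measurable_fun setT (tau k)) ->
  measurable_fun setT (change_ind N (grid_step h tau) j).
Proof.
move=> h0 mN mtau.
have macc i : measurable_fun setT (fun w => N (access_time (grid_step h tau) i w) w).
  pose M w := (\sum_(l < i) (truncn (tau l w / h)).+1)%N.
  have -> : (fun w => N (access_time (grid_step h tau) i w) w) =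
      (fun w => N (h * (M w)%:R) w).
    apply/funext => w; congr (N _ w).
    by rewrite /access_time /M natr_sum mulr_sumr.
  apply: (measurable_fun_nat_index (F := fun n => N (h * n%:R))) => //.
  apply: measurable_fun_sumn => l; under eq_fun do rewrite -addn1.
  by apply: measurable_fun_addn => //; exact: measurable_grid_index.
apply: (measurableT_comp (f := nat_of_bool)) => //.
exact: measurable_fun_ltn.
Qed.

Lemma measurable_change_pattern d (T : measurableType d) (R : realType)
    (N : R -> T -> nat) (tau : nat -> T -> R) k b :
  (forall j, measurable_fun setT (change_ind N tau j)) ->
  measurable (change_pattern N tau k b).
Proof.
move=> mI.
have -> : change_pattern N tau k b =
    \bigcap_(j in [set` iota 0 k]) change_ind N tau j.+1 @^-1` [set (b j : nat)].
  apply/seteqP; split => w wb j /=.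
    by rewrite mem_iota/= add0n; exact: wb.
  by move=> jk; apply: wb; rewrite /= mem_iota.
apply: fin_bigcap_measurable => // j _.
by rewrite -[_ @^-1` _]setTI; exact: mI.
Qed.

(** * Moment generating function of the discretised count *)

Lemma change_countE {T : Type} {R : realType} (N : R -> T -> nat)
    (tau : nat -> T -> R) (k : nat) (w : T) :
  change_count N tau k w = (\sum_(j < k) change_ind N tau j.+1 w)%N.
Proof. by rewrite /change_count big_add1 big_mkord. Qed.

(** Patterns of length [k] form a finite type that can be summed over; the default [false] beyond
    [k] is never read by [change_pattern]. *)
Definition ffun_pattern k (b : {ffun 'I_k -> bool}) (j : nat) : bool :=
  oapp b false (insub j).

Lemma ffun_patternE k (b : {ffun 'I_k -> bool}) (i : 'I_k) :
  ffun_pattern b i = b i.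
Proof. by rewrite /ffun_pattern valK. Qed.

(** Exactly one pattern occurs at each [w], so the sum has a single nonzero term, and that term
    factors over the indicators. *)
Lemma expR_change_count {T : Type} {R : realType} (N : R -> T -> nat)
    (tau : nat -> T -> R) (k : nat) (l : R) (w : T) :
  expR (l * (change_count N tau k w)%:R) =
  \sum_(b : {ffun 'I_k -> bool}) (\prod_(i < k) expR (l * (b i)%:R)) *
     \1_(change_pattern N tau k (ffun_pattern b)) w.
Proof.
pose b0 : {ffun 'I_k -> bool} := [ffun i : 'I_k => (0 < change_ind N tau i.+1 w)%N].
have b0E (i : 'I_k) : change_ind N tau i.+1 w = (b0 i : nat).
  by rewrite ffunE /change_ind; case: (_ < _)%N.
rewrite (bigD1 b0)//= [X in _ + X]big1 ?addr0; last first.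
  move=> b bb0; rewrite indicE memNset ?mulr0// => wb.
  move/eqP : bb0; apply; apply/ffunP => i.
  have := wb i (ltn_ord i); rewrite ffun_patternE b0E.
  by case: (b i); case: (b0 i).
rewrite indicE mem_set ?mulr1; last first.
  by move=> j jk; have := b0E (Ordinal jk); rewrite -ffun_patternE.
rewrite -expR_sum -mulr_sumr change_countE natr_sum; congr (expR (l * _)).
by apply: eq_bigr => i _; rewrite b0E.
Qed.

Lemma grid_mgf d (T : measurableType d) (R : realType)
    (P : probability T R) (D p h : R) (N : R -> T -> nat) (tau : nat -> T -> R)
    (k : nat) (l : R) :
  0 < D -> 0 < p -> 0 < h ->
  poisson_process P D N ->
  (forall k, measurable_fun setT (tau k)) ->
  mutual_indep P tau ->
  (forall k (B : set R), measurable B ->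
     P (tau k @^-1` B) = exponential_prob p B) ->
  indep_families P N tau ->
  (\int[P]_w (expR (l * (change_count N (grid_step h tau) k w)%:R))%:E =
   ((grid_gap D p h + expR l * (1 - grid_gap D p h)) ^+ k)%:E)%E.
Proof.
move=> D0 p0 h0 NP mtau itau Ptau Ntau; have [mN _ _ _ _] := NP.
have mpat b : measurable (change_pattern N (grid_step h tau) k b).
  by apply: measurable_change_pattern => j; exact: measurable_change_ind_grid.
have Ppat b : P (change_pattern N (grid_step h tau) k b) =
    (\prod_(j < k) gap_prob (grid_gap D p h) (b j))%:E.
  (* Summing out the cell indices leaves i.i.d. Bernoulli indicators. *)
  rewrite (measure_joint_fibers (mu := P) (M := fun j w => truncn (tau j w / h))
    (f := fun j => grid_weight D p h (b j))
    (F := fun j => gap_prob (grid_gap D p h) (b j)) (k := k) (C := 1)) ?mul1r //.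
  - by move=> j; exact: measurable_grid_index.
  - by move=> j; exact: grid_weight_series.
  - by move=> m; rewrite mul1r; exact: grid_pattern_fiber.
under eq_integral do rewrite expR_change_count -sumEFin.
rewrite ge0_integral_sum //; last 2 first.
- by move=> b; apply/measurable_EFinP/measurable_funM.
- by move=> b w _; rewrite lee_fin mulr_ge0// prodr_ge0// => i _; exact: expR_ge0.
under eq_bigr => b _.
  under eq_integral do rewrite EFinM.
  rewrite ge0_integralZl_EFin//; last 2 first.
  - exact/measurable_EFinP.
  - by rewrite prodr_ge0// => i _; exact: expR_ge0.
  rewrite integral_indic// setIT [X in (_ * X)%E](Ppat (ffun_pattern b))
    -EFinM -big_split/=.
  under eq_bigr do rewrite ffun_patternE.
  over.
(* The sum over patterns of products is the product over indices of two-term sums. *)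
rewrite sumEFin -(bigA_distr_bigA (fun (_ : 'I_k) (c : bool) =>
  expR (l * c%:R) * gap_prob (grid_gap D p h) c)).
congr EFin; rewrite prodr_const card_ord; congr (_ ^+ _).
rewrite (bigD1 false)//= (big_pred1 true); last by case.
by rewrite /= mulr0 expR0 mul1r mulr1.
Qed.

(** * Vanishing mesh *)

(** With [h] the mesh, [expR x >= 1 + x] at [a * h] and at [- (a * h)] squeezes the quotient between
    [a / (1 + a * h)] and [a]. *)
Lemma onem_expRN_div_cvg (R : realType) (a : R) : 0 < a ->
  (fun n => (1 - expR (- (a * n.+1%:R^-1))) / n.+1%:R^-1) @ \oo --> a.
Proof.
move=> a0; have hcvg : (fun n => a * n.+1%:R^-1 : R) @ \oo --> 0.
  by rewrite -[X in _ --> X](mulr0 a); apply: cvgMl_tmp; exact: cvg_harmonic.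
apply: (@squeeze_cvgr _ _ _ _ (fun n => a / (1 + a * n.+1%:R^-1)) (fun=> a)).
- apply: nearW => n; have h0 : 0 < n.+1%:R^-1 :> R by rewrite invr_gt0.
  move: (n.+1%:R^-1) h0 => h h0; have ah0 : 0 < a * h by rewrite mulr_gt0.
  apply/andP; split; [rewrite ler_pdivlMr//|rewrite ler_pdivrMr//].
    have : expR (- (a * h)) <= (1 + a * h)^-1.
      by rewrite expRN lef_pV2 ?posrE ?expR_gt0 ?addr_gt0// expR_ge1Dx.
    have -> : a / (1 + a * h) * h = 1 - (1 + a * h)^-1.
      by field; rewrite gt_eqF// addr_gt0.
    lra.
  by have := expR_ge1Dx (- (a * h)); lra.
- rewrite -[X in _ --> X]divr1; apply: cvgMl_tmp; apply: cvgV => //.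
  by rewrite -[X in _ --> X]addr0; apply: cvgD => //; exact: cvg_cst.
- exact: cvg_cst.
Qed.

Lemma grid_gap_cvg (R : realType) (D p : R) : 0 < D -> 0 < p ->
  (fun n => grid_gap D p n.+1%:R^-1) @ \oo --> p / (p + D).
Proof.
move=> D0 p0; pose f (a : R) n := (1 - expR (- (a * n.+1%:R^-1))) / n.+1%:R^-1.
(* Numerator and denominator are both divided by the mesh, so that each becomes a difference
   quotient at 0. *)
have -> : (fun n => grid_gap D p n.+1%:R^-1) =
    (fun n => f p n * expR (- (D * n.+1%:R^-1)) / f (p + D) n).
  apply/funext => n; rewrite /grid_gap /f -expRD.
  have h0 : n.+1%:R^-1 != 0 :> R by rewrite invr_eq0.
  have -> : - (p * n.+1%:R^-1) + - (D * n.+1%:R^-1) =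
    - ((p + D) * n.+1%:R^-1) :> R by ring.
  have : 1 - expR (- ((p + D) * n.+1%:R^-1)) != 0.
    by rewrite subr_eq0 eq_sym lt_eqF// -[ltRHS]expR0 ltr_expR oppr_lt0
      mulr_gt0 ?addr_gt0.
  by move: (n.+1%:R^-1) h0 => h h0 e0; field; rewrite h0.
have -> : p / (p + D) = p * 1 / (p + D) by rewrite mulr1.
apply: cvgM.
  apply: cvgM; first exact: onem_expRN_div_cvg.
  rewrite -[X in _ --> X]expR0; apply: continuous_cvg; first exact: continuous_expR.
  rewrite -[X in _ --> X]oppr0; apply: cvgN.
  by rewrite -[X in _ --> X](mulr0 D); apply: cvgMl_tmp; exact: cvg_harmonic.
apply: cvgV; first by rewrite gt_eqF// addr_gt0.
by apply: onem_expRN_div_cvg; rewrite addr_gt0.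
Qed.

(* The gaps are nonnegative only almost surely, while paths are right-continuous
   only at nonnegative times. *)
Definition pos_step {T : Type} {R : realType} (tau : nat -> T -> R)
    (j : nat) (w : T) : R :=
  maxr 0 (tau j w).

Lemma grid_step_bounds {T : Type} {R : realType} (h : R) (tau : nat -> T -> R) j w :
  0 < h ->
  pos_step tau j w <= grid_step h tau j w <= pos_step tau j w + h.
Proof.
move=> h0; rewrite /pos_step /grid_step; have [tau0|tau0] := leP 0 (tau j w).
  have := truncn_itv (divr_ge0 tau0 (ltW h0)).
  rewrite ler_pdivlMr// ltr_pdivrMr// => /andP[h1 h2].
  by rewrite mulrC (ltW h2)/= -natr1 mulrDl mul1r lerD2r.
(* A negative gap has cell index 0: its rounded step is [h] and its positive part is 0. *)
have t0 : (0 <= tau j w / h) = false.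
  by rewrite leNgt pmulr_llt0 ?invr_gt0// tau0.
rewrite truncn_floor t0 mulr1 add0r lexx andbT.
exact: ltW.
Qed.

Lemma access_time_grid_bounds {T : Type} {R : realType} (h : R)
    (tau : nat -> T -> R) j w : 0 < h ->
  access_time (pos_step tau) j w <= access_time (grid_step h tau) j w
    <= access_time (pos_step tau) j w + h * j%:R.
Proof.
move=> h0; rewrite /access_time mulr_natr -[in h *+ j](card_ord j) -sumr_const -big_split/=.
apply/andP; split; apply: ler_sum => i _;
  by have /andP[] := grid_step_bounds tau i w h0.
Qed.

(** The [j]-th rounded time exceeds the true one by at most [h * j]. Paths are locally constant to
    the right, so the counts eventually agree exactly, not merely in the limit. *)
Lemma change_count_grid_near d (T : measurableType d) (R : realType)
    (P : probability T R) (D : R) (N : R -> T -> nat) (tau : nat -> T -> R) k w :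
  poisson_process P D N ->
  \forall n \near \oo, change_count N (grid_step n.+1%:R^-1 tau) k w =
    change_count N (pos_step tau) k w.
Proof.
move=> [_ _ [_ Nrc] _ _].
have Nnear j : \forall n \near \oo,
    N (access_time (grid_step n.+1%:R^-1 tau) j w) w =
    N (access_time (pos_step tau) j w) w.
  have t0 : 0 <= access_time (pos_step tau) j w.
    by apply: sumr_ge0 => i _; rewrite /pos_step le_max lexx.
  have [e e0 Ne] := Nrc w _ t0.
  have hcvg : (fun n => n.+1%:R^-1 * j%:R : R) @ \oo --> 0.
    by rewrite -[X in _ --> X](mul0r j%:R); apply: cvgMr_tmp; exact: cvg_harmonic.
  near=> n; have h0 : 0 < n.+1%:R^-1 :> R by rewrite invr_gt0.
  have /andP[t1 t2] := access_time_grid_bounds tau j w h0.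
  apply: Ne => //; rewrite (le_lt_trans t2)// ltrD2l.
  by near: n; exact: (cvgr_lt 0).
(* Only the [k.+1] access times up to index [k] matter, so one threshold serves them all. *)
have near_all := filter_forall (F := \oo) (I := 'I_k.+1)
  (f := fun (j : 'I_k.+1) n => N (access_time (grid_step n.+1%:R^-1 tau) j w) w =
    N (access_time (pos_step tau) j w) w) _ (fun j => Nnear j).
near=> n; rewrite !change_countE; apply: eq_bigr => i _.
have eqn j : (j <= k)%N -> N (access_time (grid_step n.+1%:R^-1 tau) j w) w =
    N (access_time (pos_step tau) j w) w.
  move=> jk; have jk1 : (j < k.+1)%N by [].
  suff /(_ (Ordinal jk1)) : forall j : 'I_k.+1,
      N (access_time (grid_step n.+1%:R^-1 tau) j w) w =
      N (access_time (pos_step tau) j w) w by [].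
  by near: n; exact: near_all.
by rewrite /change_ind /= !eqn// ltnW.
Unshelve. all: by end_near. Qed.

Lemma cvg_limn_einf (R : realType) (u : (\bar R)^nat) (l : \bar R) :
  u @ \oo --> l -> limn_einf u = l.
Proof.
move=> ul; rewrite is_cvg_limn_einfE; last by apply/cvg_ex; exists l.
exact/cvg_lim.
Qed.

Lemma measurable_change_count_grid d (T : measurableType d) (R : realType)
    (h : R) (N : R -> T -> nat) (tau : nat -> T -> R) k :
  0 < h -> (forall t, measurable_fun setT (N t)) ->
  (forall k, measurable_fun setT (tau k)) ->
  measurable_fun setT (fun w => (change_count N (grid_step h tau) k w)%:R : R).
Proof.
move=> h0 mN mtau; apply: (measurableT_comp (f := fun n : nat => n%:R : R)) => //.
by apply: measurable_fun_sumn => j; exact: measurable_change_ind_grid.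
Qed.

(** [expR x] is at most [(1 - x)^-1], and multiplying the quadratic by [1 - x] gives
    [1 + x ^+ 2 * (1 - 2 * x)], which is at least 1. *)
Lemma expR_le_quadratic (R : realType) (x : R) :
  x <= 1 / 2 -> expR x <= 1 + x + 2 * x ^+ 2.
Proof.
move=> x2; have x1 : 0 < 1 - x by lra.
apply: (@le_trans _ _ (1 - x)^-1).
  rewrite -[x in expR x]opprK expRN lef_pV2 ?posrE ?expR_gt0//.
  exact: expR_ge1Dx.
rewrite -[leLHS]mul1r ler_pdivrMr//.
have -> : (1 + x + 2 * x ^+ 2) * (1 - x) = 1 + x ^+ 2 * (1 - 2 * x) by ring.
by rewrite lerDl mulr_ge0 ?sqr_ge0//; lra.
Qed.

(** * Moment generating function of the change count *)

Section mgf_change_count.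
Context d (T : measurableType d) (R : realType) (P : probability T R) (D p : R)
  (N : R -> T -> nat) (tau : nat -> T -> R).
Context (D0 : 0 < D) (p0 : 0 < p) (NP : poisson_process P D N)
  (mtau : forall k, measurable_fun setT (tau k)) (itau : mutual_indep P tau)
  (Ptau : forall k (B : set R), measurable B ->
     P (tau k @^-1` B) = exponential_prob p B)
  (Ntau : indep_families P N tau).

Let Y k w : R := (change_count N (pos_step tau) k w)%:R.

(** The count is the pointwise limit of the discretised counts, which are measurable. *)
Lemma measurable_change_count k : measurable_fun setT (Y k).
Proof.
have [mN _ _ _ _] := NP.
apply/measurable_EFinP.
apply: (emeasurable_fun_cvg
  (fun n w => (change_count N (grid_step n.+1%:R^-1 tau) k w)%:R%:E)) => [n|w _].
  by apply/measurable_EFinP; exact: measurable_change_count_grid.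
apply: cvg_near_cst; apply: filterS (change_count_grid_near tau k w NP) => n /=.
by rewrite /Y => ->.
Qed.

(** Fatou's lemma along the meshes [n.+1%:R^-1]; an inequality is all that the tail bounds
    require. *)
Lemma mgf_change_count k (l : R) :
  (\int[P]_w (expR (l * Y k w))%:E <=
   ((p / (p + D) + expR l * (1 - p / (p + D))) ^+ k)%:E)%E.
Proof.
have [mN _ _ _ _] := NP.
pose f n w := (expR (l * (change_count N (grid_step n.+1%:R^-1 tau) k w)%:R))%:E.
have mf n : measurable_fun setT (f n).
  apply/measurable_EFinP; apply: measurableT_comp => //; apply: measurable_funM => //.
  exact: measurable_change_count_grid.
have f0 n w : setT w -> (0 <= f n w)%E by rewrite lee_fin expR_ge0.
have := fatou P measurableT mf f0.
congr (_ <= _)%E.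
  apply: eq_integral => w _; apply: cvg_limn_einf.
  apply: cvg_near_cst; apply: filterS (change_count_grid_near tau k w NP) => n /=.
  by rewrite /f /Y => ->.
apply: cvg_limn_einf; under eq_fun do
  rewrite /f (grid_mgf k l D0 p0 _ NP mtau itau Ptau Ntau) ?invr_gt0//.
apply: cvg_EFin; first exact: nearW.
apply: (@continuous_cvg _ _ _ _ _
  (fun n => grid_gap D p n.+1%:R^-1 + expR l * (1 - grid_gap D p n.+1%:R^-1))
  (fun x => x ^+ k)); first exact: exprn_continuous.
have gcvg := grid_gap_cvg D0 p0.
apply: cvgD => //; apply: cvgMl_tmp; apply: cvgB => //; exact: cvg_cst.
Qed.

(** The quadratic bound and [q <= 1] give [1 - q + q * expR l <= expR (q * l + 2 * l ^+ 2)];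
    centring cancels the linear term in the [k]-th power. *)
Lemma mgf_change_count_centered k (l : R) : l <= 1 / 2 ->
  (\int[P]_w (expR (l * (Y k w - k%:R * (D / (p + D)))))%:E <=
   (expR (2 * k%:R * l ^+ 2))%:E)%E.
Proof.
move=> l2; set q := D / (p + D).
have pD0 : 0 < p + D by rewrite addr_gt0.
have q0 : 0 <= q by rewrite divr_ge0 ?ltW.
have q1 : q <= 1 by rewrite ler_pdivrMr// mul1r lerDr ltW.
have rE : p / (p + D) = 1 - q by rewrite /q; field; rewrite gt_eqF.
have mexp : measurable_fun setT (fun w => expR (l * Y k w)).
  apply: measurableT_comp => //; apply: measurable_funM => //.
  exact: measurable_change_count.
have Eexp w : (expR (l * (Y k w - k%:R * q)))%:E =
    ((expR (- (l * (k%:R * q))))%:E * (expR (l * Y k w))%:E)%E.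
  by rewrite mulrBr expRD mulrC EFinM.
under eq_integral do rewrite Eexp.
rewrite ge0_integralZl_EFin ?expR_ge0//; last exact/measurable_EFinP.
apply: le_trans (lee_wpmul2l _ (mgf_change_count k l)) _.
  by rewrite lee_fin expR_ge0.
rewrite -EFinM lee_fin.
have : p / (p + D) + expR l * (1 - p / (p + D)) <= expR (q * l + 2 * l ^+ 2).
  apply: le_trans (expR_ge1Dx _).
  have := expR_le_quadratic l2; rewrite rE => el.
  have : q * expR l <= q * (1 + l + 2 * l ^+ 2) by rewrite ler_wpM2l.
  have : q * (2 * l ^+ 2) <= 2 * l ^+ 2.
    by apply: ler_piMl => //; apply: mulr_ge0 => //; exact: sqr_ge0.
  lra.
move=> base_le; apply: (@le_trans _ _ (expR (- (l * (k%:R * q))) *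
    expR (q * l + 2 * l ^+ 2) ^+ k)).
  rewrite ler_wpM2l ?expR_ge0// lerXn2r ?nnegrE ?expR_ge0//.
  by rewrite rE opprB addrCA subrr addr0 addr_ge0 ?subr_ge0// mulr_ge0 ?expR_ge0.
by rewrite -expRM_natl -expRD ler_expR; nra.
Qed.

End mgf_change_count.

(** * Subgaussian tails *)

Lemma le_integral_EFinZ d (T : measurableType d) (R : realType)
    (mu : {measure set T -> \bar R}) (f : T -> R) (a F : R) :
  0 <= a -> measurable_fun setT f -> (forall w, 0 <= f w) ->
  (\int[mu]_w (f w)%:E <= F%:E)%E -> (\int[mu]_w (a * f w)%:E <= (a * F)%:E)%E.
Proof.
move=> a0 mf f0 fF; under eq_integral do rewrite EFinM.
rewrite ge0_integralZl_EFin //;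
  [|by move=> w _; rewrite lee_fin|exact/measurable_EFinP].
by rewrite EFinM; apply: lee_wpmul2l => //; rewrite lee_fin.
Qed.

Lemma le_integral_EFinD d (T : measurableType d) (R : realType)
    (mu : {measure set T -> \bar R}) (f g : T -> R) (F G : R) :
  measurable_fun setT f -> (forall w, 0 <= f w) ->
  measurable_fun setT g -> (forall w, 0 <= g w) ->
  (\int[mu]_w (f w)%:E <= F%:E)%E -> (\int[mu]_w (g w)%:E <= G%:E)%E ->
  (\int[mu]_w (f w + g w)%:E <= (F + G)%:E)%E.
Proof.
move=> mf f0 mg g0 fF gG; under eq_integral do rewrite EFinD.
rewrite ge0_integralD //; do ?[exact/measurable_EFinP|by move=> w _; rewrite lee_fin].
by rewrite EFinD; exact: leeD.
Qed.

Lemma geometric_nneseries_lty (R : realType) (c z : R) :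
  0 <= c -> 0 < z -> z < 1 -> (\sum_(0 <= k <oo) (c * z ^+ k)%:E < +oo)%E.
Proof.
move=> c0 z0 z1; have := cvg_geometric_series (a := c) (z := z).
rewrite gtr0_norm// => /(_ z1) gcvg.
have -> : (\sum_(0 <= k <oo) (c * z ^+ k)%:E = (c / (1 - z))%:E)%E; last exact: ltry.
apply/cvg_lim => //; under eq_fun do rewrite sumEFin.
by apply: cvg_EFin gcvg; exact: nearW.
Qed.

Section subgaussian_lln.
Context d (T : measurableType d) (R : realType) (P : probability T R)
  (Z : nat -> T -> R) (mZ : forall k, measurable_fun setT (Z k))
  (mgfZ : forall k l, l <= 1 / 2 ->
    (\int[P]_w (expR (l * Z k w))%:E <= (expR (2 * k%:R * l ^+ 2))%:E)%E).

Let mexpZ k l : measurable_fun setT (fun w => expR (l * Z k w)).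
Proof. by apply: measurableT_comp => //; exact: measurable_funM. Qed.

Lemma measurable_norm_ge k (x : R) : measurable [set w | x <= `|Z k w|].
Proof.
rewrite -[X in measurable X]setTI.
have -> : [set w | x <= `|Z k w|] = (fun w => `|Z k w|) @^-1` `[x, +oo[.
  by apply/seteqP; split => w /=; rewrite in_itv/= andbT.
have mn : measurable_fun setT (fun w => `|Z k w|) by exact: measurableT_comp.
by apply: mn => //; exact: measurable_itv.
Qed.

(** Chernoff bound on both sides. The exponent [2 * k * l ^+ 2 - l * k * e] is least at [l = e / 4],
    where it equals [- k * e ^+ 2 / 8]; [e <= 1] keeps [l] within the range of [mgfZ]. *)
Lemma subgaussian_tail k (e : R) : 0 < e -> e <= 1 ->
  (P [set w | (k%:R * e <= `|Z k w|)%R] <= (2 * expR (- (e ^+ 2 / 8)) ^+ k)%:E)%E.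
Proof.
move=> e0 e1; set A := [set w | _].
have mA : measurable A by exact: measurable_norm_ge.
pose c := expR (- (e / 4 * (k%:R * e))).
rewrite -[A]setIT -integral_indic//.
apply: (@le_trans _ _ (\int[P]_w
    (c * (expR (e / 4 * Z k w) + expR (- (e / 4) * Z k w)))%:E)%E).
  apply: ge0_le_integral => //.
  - exact/measurable_EFinP.
  - by apply/measurable_EFinP; apply: measurable_funM => //; exact: measurable_funD.
  move=> w _; rewrite lee_fin indicE.
  case: (boolP (w \in A)) => [/set_mem|_]; last first.
    by rewrite mulr_ge0 ?addr_ge0 ?expR_ge0.
  rewrite /A /= ler_normr mulrDr /c -!expRD => /orP[Zw|Zw].
    rewrite -[leLHS]addr0 lerD ?expR_ge0// -[leLHS]expR0 ler_expR.
    have : e / 4 * (k%:R * e) <= e / 4 * Z k w by rewrite ler_pM2l// divr_gt0.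
    lra.
  rewrite -[leLHS]add0r lerD ?expR_ge0// -[leLHS]expR0 ler_expR.
  have : e / 4 * (k%:R * e) <= e / 4 * - Z k w by rewrite ler_pM2l// divr_gt0.
  lra.
have -> : 2 * expR (- (e ^+ 2 / 8)) ^+ k =
    c * (expR (2 * k%:R * (e / 4) ^+ 2) + expR (2 * k%:R * (- (e / 4)) ^+ 2)).
  have -> : expR (- (e ^+ 2 / 8)) ^+ k = c * expR (2 * k%:R * (e / 4) ^+ 2).
    by rewrite /c -expRD -expRM_natl; congr expR; field.
  by rewrite sqrrN; ring.
apply: le_integral_EFinZ; [exact: expR_ge0|exact: measurable_funD| |].
  by move=> w; rewrite addr_ge0 ?expR_ge0.
apply: le_integral_EFinD;
  [exact: mexpZ| |exact: mexpZ| |apply: mgfZ; lra|apply: mgfZ; lra];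
  by move=> w; exact: expR_ge0.
Qed.

Lemma subgaussian_lln :
  \forall w \ae P, (fun k => Z k w / k%:R) @ \oo --> 0.
Proof.
have evt i : \forall w \ae P, exists n, forall k, (n <= k)%N ->
    `|Z k w| < k%:R * i.+1%:R^-1.
  set e : R := i.+1%:R^-1.
  have e0 : 0 < e by rewrite invr_gt0.
  have e1 : e <= 1 by rewrite invf_le1 ?ler1n.
  pose F k := [set w | k%:R * e <= `|Z k w|].
  (* Borel-Cantelli: the tail bounds form a convergent geometric series, and a point with no
     threshold [n] lies in infinitely many [F k]. *)
  exists (lim_sup_set F); split.
  - apply: bigcap_measurable => [|n _]; first by exists 0%N.
    by apply: bigcup_measurable => k _; exact: measurable_norm_ge.
  - apply: lim_sup_set_cvg0 => [k|]; first exact: measurable_norm_ge.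
    apply: le_lt_trans
      (geometric_nneseries_lty (c := 2) (z := expR (- (e ^+ 2 / 8))) _ _ _) => //.
    + by apply: lee_nneseries => // k _; exact: subgaussian_tail.
    + exact: expR_gt0.
    + by rewrite -[ltRHS]expR0 ltr_expR oppr_lt0 divr_gt0// exprn_gt0.
  move=> w /= nw n _; apply: contrapT => nF; apply: nw; exists n => k nk.
  by rewrite ltNge; apply/negP => Fk; apply: nF; exists k.
apply: filterS (ae_foralln evt) => w wP; apply/cvgrPdist_lt => e e0.
(* This index [i] satisfies [i.+1%:R^-1 <= e]. *)
have [n nP] := wP (truncn e^-1).
near=> k; have k0 : (0 < k)%N by near: k; exact: nbhs_infty_gt.
rewrite sub0r normrN normrM normfV normr_nat ltr_pdivrMr ?ltr0n//.
apply: lt_le_trans (nP k _) _; first by near: k; exact: nbhs_infty_ge.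
rewrite mulrC ler_wpM2r// -[leRHS]invrK lef_pV2 ?posrE ?invr_gt0//.
exact/ltW/truncnS_gt.
Unshelve. all: by end_near. Qed.

End subgaussian_lln.

(** * The estimator *)

Import HBNNSimple.

(* The smaller function is not assumed measurable: the estimator need not be,
   since the paths [N] are unconstrained at negative times. *)
Lemma ae_le_ge0_integral d (T : measurableType d) (R : realType)
    (mu : {measure set T -> \bar R}) (f g : T -> R) :
  (forall w, 0 <= f w) -> (forall w, 0 <= g w) -> measurable_fun setT g ->
  (\forall w \ae mu, f w <= g w) ->
  (\int[mu]_w (f w)%:E <= \int[mu]_w (g w)%:E)%E.
Proof.
move=> f0 g0 mg fg; rewrite ge0_integralTE; last by move=> w; rewrite lee_fin.
apply: ge_ereal_sup => _ [h /= hf <-]; rewrite -integralT_nnsfun.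
apply: ae_ge0_le_integral; [exact: measurableT| | | | |].
- by move=> w _; rewrite lee_fin.
- by apply/measurable_EFinP; exact: measurable_funPT.
- by move=> w _; rewrite lee_fin.
- by apply/measurable_EFinP.
by apply: filterS fg => w fg _; apply: le_trans (hf w) _; rewrite lee_fin.
Qed.

(** From [expR x >= 1 + x] at both signs. It turns moment generating function bounds at [s^-1] and
    [- s^-1] into a first-moment bound of order [s]. *)
Lemma normr_le_expR_sum (R : realType) (s z : R) : 0 < s ->
  `|z| <= s * (expR (s^-1 * z) + expR (- s^-1 * z)).
Proof.
move=> s0; rewrite mulrC -ler_pdivrMr//.
have -> : `|z| / s = `|s^-1 * z| by rewrite normrM gtr0_norm ?invr_gt0// mulrC.
rewrite mulNr; move: (s^-1 * z) => x.
have := expR_ge1Dx x; have := expR_ge1Dx (- x).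
have := expR_ge0 x; have := expR_ge0 (- x); rewrite ler_norml.
by move=> *; apply/andP; split; lra.
Qed.

(** A single pointwise bound, made of constants and exponentials of [Z], so that it can be
    integrated term by term. All terms are nonnegative, so each case may use only its own. *)
Lemma estimator_error_le (R : realType) (D p a k Y s : R)
    (r := p / (p + D)) (Z := Y - k * (D / (p + D))) :
  0 < D -> 0 < p -> 0 < a -> 0 < k -> 0 <= Y -> Y <= k -> 0 < s ->
  `|p * Y / (k + a - Y) - D| <=
    2 * (p + D) / (k * r) * s * (expR (s^-1 * Z) + expR (- s^-1 * Z)) +
    (2 * D * a / (k * r) +
     (p * k / a + D) * expR (- (r / 8 * (k * r / 2))) * expR (r / 8 * Z)).
Proof.
move=> D0 p0 a0 k0 Y0 Yk s0.
have pD0 : 0 < p + D by rewrite addr_gt0.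
have r0 : 0 < r by rewrite divr_gt0.
have kr0 : 0 < k * r by rewrite mulr_gt0.
have den0 : 0 < k + a - Y by lra.
have pka0 : 0 < p * k / a by rewrite divr_gt0// mulr_gt0.
have t1 : 0 <= 2 * (p + D) / (k * r) * s * (expR (s^-1 * Z) + expR (- s^-1 * Z)).
  apply: mulr_ge0; last by rewrite addr_ge0 ?expR_ge0.
  by rewrite ltW// mulr_gt0// divr_gt0// mulr_gt0.
have t2 : 0 <= 2 * D * a / (k * r).
  by rewrite ltW// divr_gt0// !mulr_gt0.
have [Zs|Zb] := leP Z (k * r / 2); last first.
  have x_ge0 : 0 <= p * Y / (k + a - Y) by rewrite divr_ge0 ?mulr_ge0// ltW.
  have x_le : p * Y / (k + a - Y) <= p * k / a.
    by rewrite ler_pM ?mulr_ge0 ?invr_ge0 ?(ltW p0) ?(ltW den0)// ?ler_pM2l//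
      lef_pV2 ?posrE//; lra.
  (* The Chernoff weight at least 1 where [Z > k * r / 2]; [r / 8] is the optimal parameter for this
     threshold. *)
  have e1 : 1 <= expR (- (r / 8 * (k * r / 2))) * expR (r / 8 * Z).
    rewrite -expRD -[leLHS]expR0 ler_expR.
    have : r / 8 * (k * r / 2) <= r / 8 * Z by rewrite ler_wpM2l ?divr_ge0 ?ltW.
    lra.
  have : p * k / a + D <=
      (p * k / a + D) * (expR (- (r / 8 * (k * r / 2))) * expR (r / 8 * Z)).
    by rewrite ler_peMr// addr_ge0 ?ltW.
  rewrite -mulrA => t3; rewrite ler_norml; apply/andP; split; lra.
have t3 : 0 <= (p * k / a + D) * expR (- (r / 8 * (k * r / 2))) * expR (r / 8 * Z).
  by rewrite !mulr_ge0 ?expR_ge0 ?addr_ge0 ?ltW.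
have -> : p * Y / (k + a - Y) - D = ((p + D) * Z - D * a) / (k + a - Y).
  by rewrite /Z; field; rewrite !gt_eqF.
rewrite normrM normfV (gtr0_norm den0) ler_pdivrMr//.
(* The denominator equals [k * r + a - Z]. *)
have kr_den : k * r / 2 <= k + a - Y.
  have : k * r = k - k * (D / (p + D)) by rewrite /r; field; rewrite gt_eqF.
  by rewrite /Z in Zs; lra.
apply: (@le_trans _ _ ((2 * (p + D) / (k * r) * s *
    (expR (s^-1 * Z) + expR (- s^-1 * Z)) + 2 * D * a / (k * r)) * (k * r / 2))).
  have -> : (2 * (p + D) / (k * r) * s *
    (expR (s^-1 * Z) + expR (- s^-1 * Z)) + 2 * D * a / (k * r)) * (k * r / 2) =
    (p + D) * (s * (expR (s^-1 * Z) + expR (- s^-1 * Z))) + D * a.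
    by field; rewrite gt_eqF //= gt_eqF.
  apply: le_trans (ler_normB _ _) _; rewrite normrM (gtr0_norm pD0).
  rewrite (ger0_norm (mulr_ge0 (ltW D0) (ltW a0))) lerD2r ler_pM2l//.
  exact: normr_le_expR_sum.
apply: ler_pM => //; [exact: addr_ge0|by rewrite divr_ge0 ?ltW|].
by rewrite addrA lerDl.
Qed.

(** The first two terms are multiples of [s^-1] and [a / k]. In the third the exponents add up to
    [- 2 * x] with [x = k * r ^+ 2 / 64]: one factor [expR (- x)] absorbs [k / a], and the other is
    at most [x^-1], hence of order [s^-1]. *)
Lemma rate_bound (R : realType) (D p a s : R)
    (k := s ^+ 2) (r := p / (p + D)) :
  0 < D -> 0 < p -> 0 < a -> 1 <= s -> k / a <= expR (k * r ^+ 2 / 64) ->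
  2 * (p + D) / (k * r) * s * (expR 2 + expR 2) +
    (2 * D * a / (k * r) +
     (p * k / a + D) * expR (- (r / 8 * (k * r / 2))) *
       expR (2 * k * (r / 8) ^+ 2)) <=
  (4 * expR 2 * (p + D) / r + 2 * D / r + 64 * (p + D) / r ^+ 2) *
    maxr s^-1 (a / k).
Proof.
move=> D0 p0 a0 s1 ka; set M := maxr _ _.
have s0 : 0 < s by lra.
have k0 : 0 < k by rewrite exprn_gt0.
have k1 : 1 <= k by rewrite exprn_ege1.
have pD0 : 0 < p + D by rewrite addr_gt0.
have r0 : 0 < r by rewrite divr_gt0.
have sM : s^-1 <= M by rewrite le_max lexx.
have aM : a / k <= M by rewrite le_max lexx orbT.
have t1 : 2 * (p + D) / (k * r) * s * (expR 2 + expR 2) <=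
    4 * expR 2 * (p + D) / r * M.
  have -> : 2 * (p + D) / (k * r) * s * (expR 2 + expR 2) =
      4 * expR 2 * (p + D) / r * s^-1.
    by rewrite /k; field; rewrite !gt_eqF.
  by rewrite ler_wpM2l// ltW// divr_gt0// !mulr_gt0 ?expR_gt0.
have t2 : 2 * D * a / (k * r) <= 2 * D / r * M.
  have -> : 2 * D * a / (k * r) = 2 * D / r * (a / k) by field; rewrite !gt_eqF.
  by rewrite ler_wpM2l// ltW// divr_gt0// mulr_gt0.
suff t3 : (p * k / a + D) * expR (- (r / 8 * (k * r / 2))) *
    expR (2 * k * (r / 8) ^+ 2) <= 64 * (p + D) / r ^+ 2 * M by lra.
set x := k * r ^+ 2 / 64.
have x0 : 0 < x by rewrite divr_gt0// mulr_gt0// exprn_gt0.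
have -> : (p * k / a + D) * expR (- (r / 8 * (k * r / 2))) *
    expR (2 * k * (r / 8) ^+ 2) = (p * (k / a) + D) * expR (- x) * expR (- x).
  rewrite -!(mulrA (_ + D)) -!expRD -[p * k / a]mulrA; congr (_ * expR _).
  by rewrite /x; field.
have e1 : (p * (k / a) + D) * expR (- x) <= p + D.
  rewrite expRN ler_pdivrMr ?expR_gt0// mulrDl lerD ?ler_wpM2l ?(ltW p0)//.
  by rewrite ler_peMr ?(ltW D0)// -[leLHS]expR0 ler_expR ltW.
have e2 : expR (- x) <= 64 / r ^+ 2 * s^-1.
  apply: (@le_trans _ _ x^-1).
    rewrite expRN lef_pV2 ?posrE ?expR_gt0//.
    by apply: le_trans (expR_ge1Dx x); rewrite lerDr.
  have -> : x^-1 = 64 / r ^+ 2 * k^-1 by rewrite /x; field; rewrite !gt_eqF.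
  rewrite ler_wpM2l ?(ltW (divr_gt0 _ (exprn_gt0 2 r0)))// lef_pV2 ?posrE//.
  by rewrite /k expr2 ler_peMr// ltW.
apply: (@le_trans _ _ ((p + D) * (64 / r ^+ 2 * s^-1))).
  apply: ler_pM => //; rewrite ?expR_ge0// mulr_ge0 ?expR_ge0//.
  by rewrite addr_ge0 ?(ltW D0)// mulr_ge0 ?divr_ge0 ?ltW.
have -> : (p + D) * (64 / r ^+ 2 * s^-1) = 64 * (p + D) / r ^+ 2 * s^-1 by ring.
by rewrite ler_wpM2l// ltW// divr_gt0 ?exprn_gt0// mulr_gt0.
Qed.

Lemma change_count_le {T : Type} {R : realType} (N : R -> T -> nat)
    (tau : nat -> T -> R) (k : nat) (w : T) : (change_count N tau k w <= k)%N.
Proof.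
rewrite change_countE -[leqRHS](card_ord k) -sum1_card.
by apply: leq_sum => i _; exact: leq_b1.
Qed.

(** The exponential law gives no mass to negative gaps, and countably many null sets combine into
    one that serves every [k]. *)
Lemma ae_change_count_pos_step d (T : measurableType d) (R : realType)
    (P : probability T R) (p : R) (N : R -> T -> nat) (tau : nat -> T -> R) :
  0 < p -> (forall k, measurable_fun setT (tau k)) ->
  (forall k (B : set R), measurable B ->
     P (tau k @^-1` B) = exponential_prob p B) ->
  \forall w \ae P, forall k,
    change_count N tau k w = change_count N (pos_step tau) k w.
Proof.
move=> p0 mtau Ptau.
have mneg : measurable [set y : R | y < 0].
  by rewrite -set_itvNyo; exact: measurable_itv.
have tau_ge0 j : \forall w \ae P, 0 <= tau j w.
  exists (tau j @^-1` [set y | y < 0]); split.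
  - by rewrite -[_ @^-1` _]setTI; exact: mtau.
  - by rewrite Ptau// exponential_prob_lt// mulr0 expR0 subrr.
  - by move=> w /= /negP; rewrite -ltNge.
apply: filterS (ae_foralln tau_ge0) => w w0 k.
have accE j : access_time tau j w = access_time (pos_step tau) j w.
  by apply: eq_bigr => i _; rewrite /pos_step max_r.
by rewrite !change_countE; apply: eq_bigr => i _; rewrite /change_ind !accE.
Qed.

Theorem theorem1 (d : measure_display) (T : measurableType d) (R : realType)
    (P : probability T R) (D p : R) (N : R -> T -> nat) (tau : nat -> T -> R)
    (alpha : nat -> R) :
  0 < D -> 0 < p ->
  poisson_process P D N ->
  (forall k, measurable_fun setT (tau k)) ->
  mutual_indep P tau ->
  (forall k (B : set R), measurable B ->
     P (tau k @^-1` B) = exponential_prob p B) ->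
  indep_families P N tau ->
  (forall k, (0 < k)%N -> 0 < alpha k) ->
  (fun k => alpha k / k%:R) @ \oo --> 0 ->
  (\forall w \ae P, (fun k => lln_estimator p alpha N tau k w) @ \oo --> D)
  /\
  ((fun k => ln (k%:R / alpha k) / k%:R) @ \oo --> 0 ->
   exists C : R, exists K : nat, forall k, (K <= k)%N ->
     (\int[P]_w (`|lln_estimator p alpha N tau k w - D|)%:E <=
      (C * maxr (Num.sqrt k%:R)^-1 (alpha k / k%:R))%:E)%E).
Proof.
move=> D0 p0 NP mtau itau Ptau Ntau a0 acvg.
have pD0 : 0 < p + D by rewrite addr_gt0.
pose q := D / (p + D); pose Y k w : R := (change_count N (pos_step tau) k w)%:R.
pose Z k w := Y k w - k%:R * q.
have mZ k : measurable_fun setT (Z k).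
  by apply: measurable_funB => //; exact: measurable_change_count NP mtau k.
have mgfZ k l : l <= 1 / 2 ->
    (\int[P]_w (expR (l * Z k w))%:E <= (expR (2 * k%:R * l ^+ 2))%:E)%E.
  exact: mgf_change_count_centered.
have mexpZ k l : measurable_fun setT (fun w => expR (l * Z k w)).
  by apply: measurableT_comp => //; exact: measurable_funM.
have count_ae := ae_change_count_pos_step N p0 mtau Ptau.
split.
  apply: filterS2 count_ae (subgaussian_lln mZ mgfZ) => w cE Zcvg.
  (* For positive [k], dividing through by [k] shows the estimator as a function of [Z k w / k] and
     [alpha k / k]. *)
  have xE : \forall k \near \oo,
      p * (Z k w / k%:R + q) / (1 + alpha k / k%:R - (Z k w / k%:R + q)) =
      lln_estimator p alpha N tau k w.
    near=> k; have k0 : (0 < k)%N by near: k; exact: nbhs_infty_gt.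
    have kR : (0 : R) < k%:R by rewrite ltr0n.
    have Yk : Y k w <= k%:R by rewrite ler_nat change_count_le.
    have den0 : k%:R + alpha k - Y k w != 0.
      by rewrite gt_eqF//; have := a0 k k0; lra.
    rewrite /lln_estimator cE -/(Y k w) /Z.
    have -> : (Y k w - k%:R * q) / k%:R + q = Y k w / k%:R.
      by field; rewrite gt_eqF.
    by field; apply/andP; split => //; rewrite gt_eqF.
  apply: cvg_trans (near_eq_cvg xE) _.
  (* [D] is the value of that function at the limits, where the denominator [1 - q] is positive. *)
  have -> : D = p * (0 + q) / (1 + 0 - (0 + q)).
    by rewrite /q; field; rewrite !gt_eqF//=; lra.
  have Zq : (fun k => Z k w / k%:R + q) @ \oo --> 0 + q.
    by apply: cvgD => //; exact: cvg_cst.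
  apply: cvgM; first exact: cvgMl_tmp.
  apply: cvgV.
    rewrite addr0 add0r subr_eq0 eq_sym lt_eqF// /q ltr_pdivrMr// mul1r.
    by rewrite ltrDr.
  by apply: cvgB => //; apply: cvgD => //; exact: cvg_cst.
move=> logcvg; pose r := p / (p + D).
have r0 : 0 < r by rewrite divr_gt0.
have r1 : r < 1 by rewrite ltr_pdivrMr// mul1r ltrDl.
(* From [k = 4] on, [(sqrt k)^-1 <= 1 / 2] lies in the range of [mgfZ]; the second bound is the
   hypothesis of [rate_bound] in logarithmic form. *)
have : \forall k \near \oo, (4 <= k)%N /\ ln (k%:R / alpha k) / k%:R < r ^+ 2 / 64.
  near=> k; split; first by near: k; exact: nbhs_infty_ge.
  by near: k; apply: (cvgr_lt 0) => //; rewrite divr_gt0// exprn_gt0.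
case=> K _ KP; exists (4 * expR 2 * (p + D) / r + 2 * D / r + 64 * (p + D) / r ^+ 2), K.
move=> k /KP [k4 lnk].
have k0 : (0 < k)%N by exact: leq_trans k4.
have kR : (0 : R) < k%:R by rewrite ltr0n.
have ak := a0 k k0.
set s := Num.sqrt k%:R.
have s0 : 0 < s by rewrite sqrtr_gt0.
have sk : k%:R = s ^+ 2 by rewrite sqr_sqrtr// ltW.
have s2 : 2 <= s.
  rewrite -(ler_pXn2r (n := 2)) ?nnegrE ?(ltW s0)//.
  by rewrite -sk -natrX ler_nat.
have ka : s ^+ 2 / alpha k <= expR (s ^+ 2 * r ^+ 2 / 64).
  rewrite -sk -[leLHS]lnK ?posrE ?divr_gt0// ler_expR.
  have -> : k%:R * r ^+ 2 / 64 = r ^+ 2 / 64 * k%:R by ring.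
  by move: lnk; rewrite ltr_pdivrMr// => /ltW.
have mgfZ2 l : l <= 1 / 2 ->
    (\int[P]_w (expR (l * Z k w))%:E <= (expR (2 * s ^+ 2 * l ^+ 2))%:E)%E.
  by rewrite -sk; exact: mgfZ.
have s_inv : s^-1 <= 1 / 2 by rewrite mul1r lef_pV2 ?posrE.
(* At this scale the exponent [2 * k * l ^+ 2] is the constant 2. *)
have mgf_s l : l = s^-1 \/ l = - s^-1 ->
    (\int[P]_w (expR (l * Z k w))%:E <= (expR 2)%:E)%E.
  move=> lE; have -> : 2 = 2 * s ^+ 2 * l ^+ 2 :> R.
    by case: lE => ->; field; rewrite gt_eqF.
  apply: mgfZ2; case: lE => -> //.
  by have : 0 < s^-1 by [rewrite invr_gt0]; lra.
pose A := 2 * (p + D) / (k%:R * r) * s.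
pose B1 := 2 * D * alpha k / (k%:R * r).
pose B2 := (p * k%:R / alpha k + D) * expR (- (r / 8 * (k%:R * r / 2))).
have kr0 : 0 < k%:R * r by rewrite mulr_gt0.
have A0 : 0 <= A by apply/ltW/mulr_gt0 => //; apply: divr_gt0 => //; exact: mulr_gt0.
have B10 : 0 <= B1.
  by apply/ltW/divr_gt0 => //; apply: mulr_gt0 => //; exact: mulr_gt0.
have B20 : 0 <= B2.
  apply: mulr_ge0; last exact: expR_ge0.
  by rewrite ltW// addr_gt0// divr_gt0// mulr_gt0.
pose E1 w := expR (s^-1 * Z k w) + expR (- s^-1 * Z k w).
have E10 w : 0 <= E1 w by rewrite addr_ge0 ?expR_ge0.
have mE1 : measurable_fun setT E1 by exact: measurable_funD.
have mE2 : measurable_fun setT (fun w => B2 * expR (r / 8 * Z k w)).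
  exact: measurable_funM.
have E20 w : 0 <= B2 * expR (r / 8 * Z k w) by rewrite mulr_ge0 ?expR_ge0.
(* The pointwise bound holds for the count built from positive parts of the gaps, hence almost
   everywhere for the original one. *)
apply: (@le_trans _ _ (\int[P]_w (A * E1 w + (B1 + B2 * expR (r / 8 * Z k w)))%:E)%E).
  apply: ae_le_ge0_integral => //.
  - by move=> w; apply: addr_ge0; [exact: mulr_ge0|exact: addr_ge0].
  - by apply: measurable_funD; [exact: measurable_funM|exact: measurable_funD].
  apply: filterS count_ae => w cE; rewrite /lln_estimator cE.
  by apply: estimator_error_le => //; rewrite ler_nat change_count_le.
apply: (@le_trans _ _ (A * (expR 2 + expR 2) +
    (B1 + B2 * expR (2 * k%:R * (r / 8) ^+ 2)))%:E).
  apply: le_integral_EFinD.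
  - exact: measurable_funM.
  - by move=> w; exact: mulr_ge0.
  - exact: measurable_funD.
  - by move=> w; exact: addr_ge0.
  - apply: le_integral_EFinZ => //; apply: le_integral_EFinD => //.
    + by apply: mgf_s; left.
    + by apply: mgf_s; right.
  apply: le_integral_EFinD => //.
    by rewrite integral_cst// [X in (_ * X)%E](probability_setT P) mule1.
  apply: le_integral_EFinZ => //.
  by apply: mgfZ; lra.
rewrite lee_fin /A /B1 /B2 sk; apply: rate_bound => //; lra.
Unshelve. all: by end_near. Qed.
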